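(* Let $G=(V,E)$ be a finite directed graph that admits an Eulerian cycle and satisfies $|O_x|=2$ for all $x\in V$. Let $b:E\to\{-1,1\}$ satisfy $\sum_{e\in O_x}b(e)=0$ for all $x\in V$, and let $h:V\to\mathbb{R}$. Consider the following two linear programs. (LP1) Find $f_1:V\to\mathbb{R}$ and $M_1\in\mathbb{R}$ so as to minimize $M_1$ subject to $$\frac{1}{|C|}\sum_{e\in C}\big(h(e_1)+b(e)f_1(e_1)\big)\leq M_1\quad\text{for all cycles } C.$$ (LP2) Find $f_2:V\to\mathbb{R}$ and $M_2\in\mathbb{R}$ so as to maximize $M_2$ subject to $$\frac{1}{|C|}\sum_{e\in C}\big(h(e_1)+b(e)f_2(e_1)\big)\geq M_2\quad\text{for all cycles } C.$$ Let $\mathcal{H}:V\to\mathbb{R}$ be the solution (unique up to an additive constant) of the Poisson equation $\Delta_V\mathcal{H}=h-(h)_V$ on $V$, and define $$f(x)=\frac12\sum_{e\in O_x}b(e)\,\nabla_V\mathcal{H}(e),\qquad x\in V.$$ Then $f$ solves both linear programs (i.e. $f_1=f$ is optimal for (LP1) and $f_2=f$ is optimal for (LP2)), and the optimal values satisfy $$M_1=(h)_V=M_2.$$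
   Context: A finite directed graph $G=(V,E)$ has vertex set $V$ and edge set $E\subset V^2$; each $e=(e_1,e_2)\in E$ is a directed edge from $e_1$ to $e_2$. For $x\in V$, $O_x=\{e\in E: e_1=x\}$ is the set of outgoing edges. A path is a sequence of edges $e^1,\dots,e^m$ with $e^i_2=e^{i+1}_1$ for $i=1,\dots,m-1$. A cycle $C$ is a path with $e^m_2=e^1_1$ (vertices and edges may repeat); $|C|$ denotes the number of edges in the sequence, and $\sum_{e\in C}$ is the sum over the edges in the sequence. An Eulerian cycle is a cycle that traverses every edge $e\in E$ exactly once. For $u:V\to\mathbb{R}$ define the gradient $\nabla_V u(e)=u(e_1)-u(e_2)$ for $e\in E$, the graph Laplacian $\Delta_V u(x)=\frac{1}{|O_x|}\sum_{e\in O_x}\nabla_V u(e)$ for $x\in V$, and the average $(u)_V=\frac{1}{|V|}\sum_{x\in V}u(x)$. *)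

(* Defs.v *)
From mathcomp Require Import all_boot all_order all_algebra.
From mathcomp Require Import reals.

Set Implicit Arguments.
Unset Strict Implicit.
Unset Printing Implicit Defensive.

Import Order.TTheory GRing.Theory Num.Theory.
Local Open Scope ring_scope.

Section Graph.
Variables (V : finType) (E : {set V * V}).

Definition out (x : V) : {set V * V} := [set e in E | e.1 == x].

(* [path.cycle r] also checks the wrap-around step from the last edge to the
   first. It accepts the empty sequence, which is excluded here because
   averages over a cycle divide by its length. *)
Definition is_cycle (C : seq (V * V)) : bool :=
  [&& C != [::], all (fun e => e \in E) C
    & path.cycle (fun e e' : V * V => e.2 == e'.1) C].

Definition is_eulerian_cycle (C : seq (V * V)) : Prop :=
  is_cycle C /\ (forall e, e \in E -> count_mem e C = 1%N).

Variable R : realType.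

Definition grad (u : V -> R) (e : V * V) : R := u e.1 - u e.2.

Definition laplacian (u : V -> R) (x : V) : R :=
  #|out x|%:R^-1 * \sum_(e in out x) grad u e.

Definition average (u : V -> R) : R := #|V|%:R^-1 * \sum_(x : V) u x.

Definition solves_poisson (h H : V -> R) : Prop :=
  forall x, laplacian H x = h x - average h.

Definition poisson_control (b : V * V -> R) (H : V -> R) (x : V) : R :=
  2^-1 * \sum_(e in out x) b e * grad H e.

Section LinearPrograms.
Variables (b : V * V -> R) (h : V -> R).

Definition cycle_mean (f : V -> R) (C : seq (V * V)) : R :=
  (size C)%:R^-1 * \sum_(e <- C) (h e.1 + b e * f e.1).

Definition feasible_min (f : V -> R) (M : R) : Prop :=
  forall C, is_cycle C -> cycle_mean f C <= M.

Definition optimal_min (f : V -> R) (M : R) : Prop :=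
  feasible_min f M /\ (forall f' M', feasible_min f' M' -> M <= M').

Definition feasible_max (f : V -> R) (M : R) : Prop :=
  forall C, is_cycle C -> M <= cycle_mean f C.

Definition optimal_max (f : V -> R) (M : R) : Prop :=
  feasible_max f M /\ (forall f' M', feasible_max f' M' -> M' <= M).

End LinearPrograms.
End Graph.

(* Main.v *)
(* The control [f] is chosen so that [h e.1 + b e * f e.1 = average h + grad H e]
   on every edge; gradients sum to 0 along cycles, so every cycle has mean
   [average h].  Conversely, on the Eulerian cycle the control terms cancel at
   each vertex for any [f], so its mean is always [average h] and no value can
   do better.  For the Poisson equation, an Eulerian graph carries as many
   incoming as outgoing edges at each vertex, which gives the energy identity
   [\sum_e (grad u e)^2 = 2 \sum_e u e.1 * grad u e]: harmonic functions are
   constant, so [u |-> laplacian u + average u] is injective, hence onto. *)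
Require Import Defs.
From HB Require Import structures.
From mathcomp Require Import all_boot all_order all_algebra.
From mathcomp Require Import reals ring.

Set Implicit Arguments.
Unset Strict Implicit.
Unset Printing Implicit Defensive.

Import Order.TTheory GRing.Theory Num.Theory.
Local Open Scope ring_scope.

(** * Sums and potentials along cycles *)

Section Cycles.
Variables (V : finType) (E : {set V * V}).

Lemma sum_grad_cycle (R : realType) (u : V -> R) (C : seq (V * V)) :
  is_cycle E C -> \sum_(e <- C) grad u e = 0.
Proof.
case: C => [|e0 C]; first by case/and3P.
case/and3P => _ _ /=.
(* Telescoping is proved for open paths: [e'] only marks the vertex where [e :: C'] ends. The closed
   cycle is the case [e' = e0]. *)
suff path_sum e C' e' : path (fun d d' : V * V => d.2 == d'.1) e (rcons C' e') ->
    \sum_(d <- e :: C') grad u d = u e.1 - u e'.1.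
  by move/path_sum ->; rewrite subrr.
elim: C' e => [|d C' IH] e /=.
  by rewrite andbT big_seq1 /grad => /eqP ->.
by case/andP => /eqP ed /IH; rewrite big_cons => ->; rewrite /grad ed; ring.
Qed.

Lemma eulerian_perm (C : seq (V * V)) :
  is_eulerian_cycle E C -> perm_eq C (enum E).
Proof.
case=> /and3P[_ /allP CE _] C1; rewrite perm_sym uniq_perm ?enum_uniq //.
  apply: count_mem_uniq => e; have [/CE/C1->//|eC] := boolP (e \in C).
  exact/count_memPn.
move=> e; rewrite mem_enum; apply/idP/idP => [eE|/CE //].
by rewrite -has_pred1 has_count C1.
Qed.

Lemma eulerian_sum (R : realType) (F : V * V -> R) (C : seq (V * V)) :
  is_eulerian_cycle E C -> \sum_(e <- C) F e = \sum_(e in E) F e.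
Proof. by move=> eC; rewrite (perm_big _ (eulerian_perm eC)) big_enum. Qed.

Lemma sum_out (R : realType) (F : V * V -> R) :
  \sum_(e in E) F e = \sum_x \sum_(e in out E x) F e.
Proof.
rewrite (partition_big (fun e : V * V => e.1) predT) //=.
by apply: eq_bigr => x _; apply: eq_bigl => e; rewrite inE.
Qed.

(** Serves as connectedness: equality across each edge carries one value along the whole cycle, and
    the Eulerian cycle contains every edge. *)
Lemma cycle_grad0_const (T : eqType) (u : V -> T) (C : seq (V * V)) :
  is_cycle E C -> {in E, forall e, u e.1 = u e.2} ->
  exists c, {in C, forall e, u e.1 = c}.
Proof.
case: C => [|e0 C]; first by case/and3P.
case/and3P => _ /allP CE /=; rewrite rcons_path => /andP[C_path _] uE.
exists (u e0.1); elim: C e0 CE C_path => [|d C IH] e CE /= p f; first by rewrite inE => /eqP ->.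
case/andP: p => /eqP ed p; rewrite inE => /orP[/eqP -> //|fC].
rewrite (uE e) ?CE ?mem_head // ed; apply: IH => // g gC.
by apply: CE; rewrite inE gC orbT.
Qed.

End Cycles.

(** * Solvability and uniqueness for the Poisson equation *)

Section Poisson.
Variables (R : realType) (V : finType) (E : {set V * V}).
Hypothesis eulerian : exists C : seq (V * V), is_eulerian_cycle E C.
Hypothesis out_degree2 : forall x : V, #|out E x| = 2%N.

Lemma sum_grad_eulerian (u : V -> R) : \sum_(e in E) grad u e = 0.
Proof.
by case: eulerian => C eC; rewrite -(eulerian_sum _ eC) (sum_grad_cycle u eC.1).
Qed.

Lemma card_vertices_neq0 : #|V|%:R != 0 :> R.
Proof.
rewrite pnatr_eq0 -lt0n; case: eulerian => -[|e C] [/and3P[//]] _ _ _ _.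
by apply/card_gt0P; exists e.1.
Qed.

Lemma sum_out_grad (u : V -> R) x :
  \sum_(e in out E x) grad u e = 2 * laplacian E u x.
Proof. by rewrite /laplacian out_degree2 mulVKf ?pnatr_eq0. Qed.

Lemma sum_laplacian (u : V -> R) : \sum_x laplacian E u x = 0.
Proof.
apply: (@mulfI _ 2); rewrite ?pnatr_eq0 // mulr0 mulr_sumr.
rewrite -[RHS](sum_grad_eulerian u) sum_out.
by apply: eq_bigr => x _; rewrite sum_out_grad.
Qed.

Lemma energy_laplacian (u : V -> R) :
  \sum_(e in E) grad u e ^+ 2 = 4 * \sum_x u x * laplacian E u x.
Proof.
(* Edgewise, (a - b)^2 = 2a(a - b) - (a^2 - b^2). The last term is the gradient of [u ^+ 2], so it
   sums to 0 over [E]; the other factor 2 in the 4 is the out-degree. *)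
have -> : 4 * \sum_x u x * laplacian E u x
    = \sum_(e in E) (2 * (u e.1 * grad u e) - grad (fun x => u x ^+ 2) e).
  rewrite sumrB sum_grad_eulerian subr0 sum_out mulr_sumr; apply: eq_bigr => x _.
  transitivity (2 * u x * \sum_(e in out E x) grad u e).
    by rewrite sum_out_grad; ring.
  rewrite mulr_sumr; apply: eq_bigr => e.
  by rewrite inE => /andP[_ /eqP <-]; rewrite mulrA.
by apply: eq_bigr => e _; rewrite /grad; ring.
Qed.

Lemma harmonic_const (u : V -> R) :
  (forall x, laplacian E u x = 0) -> exists c, forall x, u x = c.
Proof.
move=> u0; have uE : {in E, forall e, u e.1 = u e.2}.
  move=> e eE; apply/eqP; rewrite -subr_eq0 -sqrf_eq0; apply/eqP.
  apply: (@psumr_eq0P _ _ (mem E) (fun e => grad u e ^+ 2)) => //.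
    by move=> d _; apply: sqr_ge0.
  by rewrite energy_laplacian big1 ?mulr0 // => x _; rewrite u0 mulr0.
case: eulerian => C eC; have [c uC] := cycle_grad0_const eC.1 uE.
(* Positive out-degree makes every vertex the source of some edge of the Eulerian cycle. *)
exists c => x; have /card_gt0P[e] : (0 < #|out E x|)%N by rewrite out_degree2.
rewrite inE => /andP[eE /eqP <-]; apply: uC.
by rewrite (perm_mem (eulerian_perm eC)) mem_enum.
Qed.

Lemma laplacian_linear (a : R) (u v : V -> R) x :
  laplacian E (fun y => a * u y + v y) x = a * laplacian E u x + laplacian E v x.
Proof.
rewrite /laplacian mulrCA -mulrDr; congr (_ * _); rewrite mulr_sumr -big_split /=.
by apply: eq_bigr => e _; rewrite /grad; ring.
Qed.

Lemma average_linear (a : R) (u v : V -> R) :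
  average (fun y => a * u y + v y) = a * average u + average v.
Proof. by rewrite /average big_split /= -mulr_sumr mulrDr mulrCA. Qed.

Lemma average_const (c : R) : average (fun _ : V => c) = c.
Proof.
by rewrite /average sumr_const -[c *+ _]mulr_natl mulKf ?card_vertices_neq0.
Qed.

Lemma poisson_unique (h H1 H2 : V -> R) :
  solves_poisson E h H1 -> solves_poisson E h H2 ->
  exists c : R, forall x : V, H1 x = H2 x + c.
Proof.
move=> H1h H2h; have [|c cP] := @harmonic_const (fun x => -1 * H2 x + H1 x).
  by move=> x; rewrite laplacian_linear H1h H2h; ring.
by exists c => x; rewrite -(cP x); ring.
Qed.

(** The Laplacian has mean 0, so averaging isolates the shift. This yields both the trivial kernel
    and the mean-zero solution below. *)
Lemma average_shifted_laplacian (u : V -> R) :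
  average (fun x => laplacian E u x + average u) = average u.
Proof.
rewrite {1}/average big_split /= sum_laplacian add0r.
exact: average_const.
Qed.

Lemma poisson_exists (h : V -> R) : exists H : V -> R, solves_poisson E h H.
Proof.
(* Over [R^o] these finite functions form a finite-dimensional space, where a trivial kernel makes
   [L] invertible. *)
pose L (u : {ffun V -> R^o}) : {ffun V -> R^o} :=
  [ffun x => laplacian E u x + average u].
have L_linear : linear L.
  move=> a u v; apply/ffunP => x; rewrite !ffunE.
  have E1 y : (a *: u + v) y = a * u y + v y by rewrite !ffunE.
  have -> : laplacian E (a *: u + v) x = a * laplacian E u x + laplacian E v x.
    rewrite -laplacian_linear /laplacian; congr (_ * _).
    by apply: eq_bigr => e _; rewrite /grad !E1.
  have -> : average (a *: u + v) = a * average u + average v.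
    rewrite -average_linear /average; congr (_ * _).
    by apply: eq_bigr => y _; rewrite E1.
  by rewrite /GRing.scale /=; ring.
pose Lm := GRing.isLinear.Build _ _ _ _ L L_linear.
pose LL : {linear {ffun V -> R^o} -> {ffun V -> R^o}} := HB.pack L Lm.
have L_ker : lker (linfun LL) == 0%VS.
  apply/lker0P => u v; rewrite !lfunE => /eqP.
  rewrite -subr_eq0 -linearB => /eqP Luv.
  apply/eqP; rewrite -subr_eq0; apply/eqP; move: (u - v) Luv => w Lw.
  have Lw0 x : laplacian E w x + average w = 0.
    by move/ffunP: Lw => /(_ x); rewrite !ffunE.
  have w0 : average w = 0.
    rewrite -average_shifted_laplacian -[RHS]average_const /average.
    by congr (_ * _); apply: eq_bigr => x _.
  have [|c wc] := @harmonic_const w.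
    by move=> x; rewrite -[LHS]addr0 -w0 Lw0.
  apply/ffunP => x; rewrite ffunE wc -w0 -[LHS]average_const /average.
  by congr (_ * _); apply: eq_bigr => y _.
pose H := ((linfun LL)^-1%VF [ffun x => h x - average h : R^o]).
have LH x : laplacian E H x + average H = h x - average h.
  have := lker0_lfunVK L_ker [ffun x => h x - average h : R^o].
  by rewrite lfunE => /ffunP /(_ x); rewrite !ffunE.
(* The right-hand side has mean 0, hence so does [H], and the shift disappears from the equation. *)
have H0 : average H = 0.
  rewrite -average_shifted_laplacian.
  transitivity (average (fun x => (-1) * average h + h x)).
    by congr (_ * _); apply: eq_bigr => x _; rewrite LH; ring.
  by rewrite average_linear average_const; ring.
by exists H => x; rewrite -LH H0 addr0.
Qed.

End Poisson.

(** * The control [f] and the means over cycles *)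

Section Control.
Variables (R : realType) (V : finType) (E : {set V * V}).
Hypothesis eulerian : exists C : seq (V * V), is_eulerian_cycle E C.
Hypothesis out_degree2 : forall x : V, #|out E x| = 2%N.
Variable b : V * V -> R.
Hypothesis b_sign : forall e : V * V, e \in E -> b e = -1 \/ b e = 1.
Hypothesis b_sum0 : forall x : V, \sum_(e in out E x) b e = 0.
Variable h : V -> R.

(** Let D, D' be the gradients on the edges [e], [e'] leaving a vertex. The Poisson equation gives
    [h - average h] = (D + D')/2; since [b e' = - b e] and [b e] squares to 1, the control term is
    (D - D')/2. They add up to D. *)
Lemma poisson_control_edge (H : V -> R) : solves_poisson E h H ->
  {in E, forall e, h e.1 + b e * poisson_control E b H e.1 = average h + grad H e}.
Proof.
move=> Hh e eE; have eO : e \in out E e.1 by rewrite inE eE eqxx.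
have /eqP/cards1P[e' De] : #|out E e.1 :\ e| = 1%N.
  by have := cardsD1 e (out E e.1); rewrite out_degree2 eO add1n => -[<-].
have := b_sum0 e.1; rewrite (big_setD1 e) //= De big_set1 => /eqP.
rewrite addrC addr_eq0 => /eqP be'.
have -> : h e.1 = 2^-1 * (grad H e + grad H e') + average h.
  have := Hh e.1; rewrite /laplacian out_degree2 (big_setD1 e) //= De big_set1.
  by move->; rewrite subrK.
rewrite /poisson_control (big_setD1 e) //= De big_set1 be'.
have be2 : b e * b e = 1 by case: (b_sign eE) => ->; rewrite ?mulrNN mulr1.
transitivity (average h + 2^-1 * (grad H e + grad H e')
  + 2^-1 * (b e * b e) * (grad H e - grad H e')); first by ring.
by rewrite be2; field.
Qed.

Lemma cycle_mean_poisson_control (H : V -> R) C :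
  solves_poisson E h H -> is_cycle E C ->
  cycle_mean b h (poisson_control E b H) C = average h.
Proof.
move=> Hh cC; have /and3P[C0 /allP CE _] := cC.
rewrite /cycle_mean (eq_big_seq (fun e => average h + grad H e)); last first.
  by move=> e /CE; apply: poisson_control_edge.
rewrite big_split /= (sum_grad_cycle H cC) addr0 big_const_seq count_predT.
by rewrite iter_addr_0 -[average h *+ _]mulr_natl mulKf // pnatr_eq0 size_eq0.
Qed.

(** The Eulerian cycle leaves each vertex twice, so both the sum of [h] along it and its length
    acquire a factor 2, which cancels in the mean. *)
Lemma cycle_mean_eulerian (f : V -> R) C :
  is_eulerian_cycle E C -> cycle_mean b h f C = average h.
Proof.
move=> eC.
have sum_h : \sum_(e <- C) (h e.1 + b e * f e.1) = 2 * \sum_x h x.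
  rewrite (eulerian_sum _ eC) sum_out mulr_sumr; apply: eq_bigr => x _.
  transitivity (\sum_(e in out E x) (h x + b e * f x)).
    by apply: eq_bigr => e; rewrite inE => /andP[_ /eqP ->].
  rewrite big_split /= -mulr_suml b_sum0 mul0r addr0 sumr_const out_degree2.
  by rewrite mulr_natl.
have size_C : (size C)%:R = 2 * #|V|%:R :> R.
  rewrite -sum1_size natr_sum (eulerian_sum _ eC) sum_out.
  rewrite -sumr_const mulr_sumr.
  by apply: eq_bigr => x _; rewrite sumr_const out_degree2 mulr1.
rewrite /cycle_mean sum_h size_C /average.
by field; rewrite (card_vertices_neq0 R eulerian).
Qed.

End Control.

Theorem theorem3p2 (R : realType) (V : finType) (E : {set V * V})
    (eulerian : exists C : seq (V * V), is_eulerian_cycle E C)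
    (out_degree2 : forall x : V, #|out E x| = 2%N)
    (b : V * V -> R)
    (b_sign : forall e : V * V, e \in E -> b e = -1 \/ b e = 1)
    (b_sum0 : forall x : V, \sum_(e in out E x) b e = 0)
    (h : V -> R) :
  (exists H : V -> R, solves_poisson E h H) /\
  (forall H1 H2 : V -> R, solves_poisson E h H1 -> solves_poisson E h H2 ->
     exists c : R, forall x : V, H1 x = H2 x + c) /\
  (forall H : V -> R, solves_poisson E h H ->
     optimal_min E b h (poisson_control E b H) (average h) /\
     optimal_max E b h (poisson_control E b H) (average h)).
Proof.
split; first exact: poisson_exists.
split; first by move=> H1 H2; apply: poisson_unique.
move=> H Hh; have [C eC] := eulerian.
(* Feasibility holds with equality on every cycle; a competitor's bound need only be tested on the
   Eulerian cycle. *)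
split; split.
- by move=> D cD; rewrite cycle_mean_poisson_control.
- by move=> f' M' /(_ C eC.1); rewrite (cycle_mean_eulerian _ _ _ _ _ eC).
- by move=> D cD; rewrite cycle_mean_poisson_control.
- by move=> f' M' /(_ C eC.1); rewrite (cycle_mean_eulerian _ _ _ _ _ eC).
Qed.
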